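(* Let $f:\mathbb{R}^n\to\mathbb{R}\cup\{+\infty\}$ be a proper lower semicontinuous function with limiting subdifferential $\partial f$, let $\psi:\mathbb{R}_+\to\mathbb{R}_+$ be a convex admissible function and let $(\bar x,0)\in{\rm gph}(\partial f)$. Suppose that ${\rm gph}(\partial f)$ is closed and that there exist $\kappa,r\in(0,+\infty)$ such that $$\kappa\|h\|^2\,\eta_\psi(x,v)(h)\le\langle z,h\rangle$$ for all $(x,v)\in{\rm gph}(\partial f)$ and $h\in\mathbb{R}^n$ with $(x,v,h)\in B(\bar x,r)\times B(0,r)\times B(0,r)$ and all $z\in\partial^2f(x,v)(h)$. Then $\partial f$ is metrically $\psi$-regular at $(\bar x,0)$.
   Context: $\mathbb{R}^n$ carries the Euclidean norm; $B(x,r)$ is the open ball; $\mathbb{R}_+=[0,+\infty)$; $d(x,A)=\inf_{a\in A}\|x-a\|$, $d(x,\emptyset)=+\infty$; for a nondecreasing $g$ on $\mathbb{R}_+$, $g(+\infty):=\lim_{t\to+\infty}g(t)\in[0,+\infty]$. Admissible function: a nondecreasing $\psi:\mathbb{R}_+\to\mathbb{R}_+$ with $\psi(0)=0$ such that $\psi(t)\to0$ implies $t\to0$. $\psi'_+$ is the right derivative of $\psi$. Limiting (Mordukhovich) normal cone of a set $A\subset\mathbb{R}^m$ at $a\in A$: $\tilde N(A,a)$ is the set of limits of sequences $a_k^*$ with $a_k^*\in\hat N(A,a_k)$, $a_k\in A$, $a_k\to a$, where $\hat N(A,a_k)=\{a^*:\limsup_{y\to a_k,\,y\in A,\,y\ne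 a_k}\langle a^*,y-a_k\rangle/\|y-a_k\|\le0\}$. Limiting subdifferential: $\partial f(x)=\{v:(v,-1)\in\tilde N({\rm epi}(f),(x,f(x)))\}$ for $x\in{\rm dom}(f)$, $\partial f(x)=\emptyset$ otherwise. ${\rm gph}(\partial f)=\{(x,v):v\in\partial f(x)\}$, $(\partial f)^{-1}(v)=\{x:v\in\partial f(x)\}$. Second subdifferential: for $(x,v)\in{\rm gph}(\partial f)$ and $h\in\mathbb{R}^n$, $\partial^2f(x,v)(h)=\{z\in\mathbb{R}^n:(z,-h)\in\tilde N({\rm gph}(\partial f),(x,v))\}$. $\eta_\psi(x,v)(h):=\psi'_+\big(d(x,(\partial f)^{-1}(v-h))\big)$ for $(x,v)\in{\rm gph}(\partial f)$, $h\in\mathbb{R}^n$. Metric $\psi$-regularity of $\partial f$ at $(\bar x,0)$: there exist $r',\tau',\kappa'\in(0,+\infty)$ such that $\psi(\tau' d(x,(\partial f)^{-1}(y)))\le\kappa' d(y,\partial f(x))$ for all $(x,y)\in B(\bar x,r')\times B(0,r')$. *)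

(* Defs.v *)
From mathcomp Require Import all_boot all_order all_algebra.
From mathcomp Require Import all_classical all_reals all_analysis.
Set Implicit Arguments.
Unset Strict Implicit.
Unset Printing Implicit Defensive.
Import Order.TTheory GRing.Theory Num.Theory.
Import numFieldNormedType.Exports.
Local Open Scope classical_set_scope.
Local Open Scope ring_scope.

(* The norm MathComp-Analysis puts on 'rV[R]_n is the sup norm, so the Euclidean
   norm, balls and distance are defined here.  Both norms induce the same
   topology, hence convergence, closedness and lower semicontinuity below are
   those of the library. *)
Section Euclidean.
Context {R : realType} {n : nat}.
Implicit Types (u v x : 'rV[R]_n) (A : set 'rV[R]_n).

Definition dotp u v : R := \sum_(i < n) u 0 i * v 0 i.

Definition enorm u : R := Num.sqrt (dotp u u).

Definition eball x (r : R) : set 'rV[R]_n := [set y | enorm (y - x) < r].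

(* equal to +oo when A is empty *)
Definition edistance x A : \bar R := ereal_inf [set (enorm (x - a))%:E | a in A].

(* When a is isolated in A the limsup is -oo, so that every vector is normal. *)
Definition frechet_normal A (a : 'rV[R]_n) : set 'rV[R]_n :=
  [set s | (limf_esup (fun y : 'rV[R]_n => (dotp s (y - a) / enorm (y - a))%:E)
                      (within A a^') <= 0)%E].

Definition limiting_normal A (a : 'rV[R]_n) : set 'rV[R]_n :=
  [set s | exists a_ s_ : nat -> 'rV[R]_n,
     [/\ forall k, A (a_ k), a_ @ \oo --> a,
         forall k, frechet_normal A (a_ k) (s_ k) & s_ @ \oo --> s]].

End Euclidean.

Section SetValuedMaps.
Context {R : realType} {n m : nat}.
Implicit Type F : 'rV[R]_n -> set 'rV[R]_m.

(* R^n x R^m is identified with R^(n + m), the pair (x, y) being row_mx x y. *)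
Definition gph F : set 'rV[R]_(n + m) := [set w | F (lsubmx w) (rsubmx w)].

Definition inv_map F (y : 'rV[R]_m) : set 'rV[R]_n := [set x | F x y].

End SetValuedMaps.

Section Subdifferentials.
Context {R : realType} {n : nat}.
Implicit Types (f : 'rV[R]_n -> \bar R) (x v h : 'rV[R]_n).

Definition proper_function f := (forall x, f x != -oo%E) /\ exists x, (f x < +oo)%E.

Definition epi f : set 'rV[R]_(n + 1) :=
  [set w | (f (lsubmx w) <= (rsubmx w 0 0)%:E)%E].

Definition subdiff f x : set 'rV[R]_n :=
  [set v | f x \is a fin_num /\
     limiting_normal (epi f) (row_mx x (fine (f x))%:M) (row_mx v (-1)%:M)].

Definition second_subdiff f x v h : set 'rV[R]_n :=
  [set z | limiting_normal (gph (subdiff f)) (row_mx x v) (row_mx z (- h))].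

End Subdifferentials.

Section Admissible.
Context {R : realType}.
Implicit Types psi g : R -> R.

(* A function on R_+ is represented by a function on R of which only the
   restriction to [0, +oo[ matters. *)
Definition admissible psi :=
  [/\ {in `[0, +oo[ &, {homo psi : s t / s <= t}},
      forall t, 0 <= t -> 0 <= psi t,
      psi 0 = 0 &
      forall t_ : nat -> R, (forall k, 0 <= t_ k) ->
        psi (t_ k) @[k --> \oo] --> (0 : R) -> t_ @ \oo --> (0 : R)].

Definition right_derivative psi (t : R) : R :=
  lim ((psi (t + s) - psi t) / s @[s --> 0^'+]).

(* The extension of a nondecreasing function on R_+ to [0, +oo] by its limit at
   +oo; the value at -oo is irrelevant. *)
Definition extend g (t : \bar R) : \bar R :=
  match t with
  | r%:E => (g r)%:E
  | +oo%E => lim ((g s)%:E @[s --> +oo])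
  | -oo%E => 0%E
  end.

Definition eta_psi {n : nat} psi (f : 'rV[R]_n -> \bar R) (x v h : 'rV[R]_n)
    : \bar R :=
  extend (right_derivative psi)
         (edistance x (inv_map (subdiff f) (v - h))).

Definition metrically_regular {n m : nat} psi (F : 'rV[R]_n -> set 'rV[R]_m)
    (xbar : 'rV[R]_n) (ybar : 'rV[R]_m) :=
  exists r' tau' kappa' : R, [/\ 0 < r', 0 < tau', 0 < kappa' &
    forall x y, eball xbar r' x -> eball ybar r' y ->
      (extend psi (tau'%:E * edistance x (inv_map F y))
       <= kappa'%:E * edistance y (F x))%E].

End Admissible.

(* Main.v *)
(* Let S be the set of x' with y in F(x'), where F = subdiff f.  Starting from
   (x, v) in gph F with residual a = |v - y|, minimise |w - y| + C |u - x|^2 over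
   gph F for C = a / rho^2; a minimiser (u, w) exists and satisfies
   |u - x| <= rho.  If w <> y, then with h = w - y the penalised objective gives
   the proximal, hence limiting, normal (- 2 C |h| (u - x), - h) to gph F at
   (u, w), and the second-order hypothesis bounds kappa psi'_+(d(u, S)) by
   2 C |u - x| <= 2 a / rho.  If moreover d(x, S) >= 2 rho, then d(u, S) >= rho
   and w = y is impossible, while psi'_+ >= psi(rho) / rho on [rho, +oo] by
   convexity; thus kappa psi(rho) <= 2 a.  Applied at (xbar, 0) with a fixed rho
   this shows that S is nonempty and close to xbar; applied at (x, v) with
   rho = d(x, S) / 4 it gives regularity. *)
Require Import Defs.
From mathcomp Require Import all_boot all_order all_algebra.
From mathcomp Require Import all_classical all_reals all_analysis.
From mathcomp Require Import ring lra.
Set Implicit Arguments.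
Unset Strict Implicit.
Unset Printing Implicit Defensive.
Import Order.TTheory GRing.Theory Num.Theory.
Import numFieldNormedType.Exports.
Local Open Scope classical_set_scope.
Local Open Scope ring_scope.

(** * Right derivatives of convex admissible functions *)

Section ConvexAdmissible.
Context {R : realType} (psi : R -> R).
Hypothesis psi_admissible : admissible psi.
Hypothesis psi_convex : convex_function (E := R^o) `[0, +oo[%classic psi.

Let quotient t s := (psi (t + s) - psi t) / s.

Lemma admissible_le a b : 0 <= a -> a <= b -> psi a <= psi b.
Proof.
case: psi_admissible => + _ _ _ a0 ab; apply=> //; rewrite in_itv/= andbT //.
exact: le_trans ab.
Qed.

(** If [psi a] vanished, the constant sequence [a] would have to tend to 0 by admissibility. *)
Lemma admissible_gt0 a : 0 < a -> 0 < psi a.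
Proof.
case: psi_admissible => _ psi_ge0 psi0 psi_cvg a0.
rewrite lt_neqAle psi_ge0 ?ltW// andbT eq_sym; apply/eqP => psia0.
have : a @[_ --> \oo] --> (0 : R).
  by apply: psi_cvg => [_|]; [exact: ltW|rewrite psia0; exact: cvg_cst].
move/(cvg_unique (@norm_hausdorff _ _))/(_ (cvg_cst a)) => a_eq0.
by rewrite -a_eq0 ltxx in a0.
Qed.

(** Convexity cleared of denominators: [a = c] is allowed, and slope comparisons become linear. *)
Lemma convex_chord a b c : 0 <= a -> a <= b -> b <= c ->
  (c - a) * psi b <= (c - b) * psi a + (b - a) * psi c.
Proof.
move=> a0 ab bc.
have [ca|ca] := eqVneq c a.
  have -> : b = a by apply/le_anti; rewrite ab -ca bc.
  by rewrite ca; lra.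
have {}ca : 0 < c - a.
  by rewrite subr_gt0 lt_neqAle eq_sym ca (le_trans ab).
have t01 : 0 <= (c - b) / (c - a) <= 1.
  by rewrite ler_pdivlMr// mul0r subr_ge0 bc ler_pdivrMr// mul1r lerB.
have [t0 t1] := andP t01.
pose t := Itv01 t0 t1.
pose p := (c - b) / (c - a).
have psi_p : psi (p * a + (1 - p) * c) <= p * psi a + (1 - p) * psi c.
  apply: (psi_convex t); rewrite inE/= in_itv/= andbT//.
  exact: le_trans a0 (le_trans ab bc).
have pE : p * a + (1 - p) * c = b by rewrite /p; field; rewrite gt_eqF.
rewrite pE in psi_p.
apply: le_trans (_ : (c - a) * (p * psi a + (1 - p) * psi c) <= _).
  by rewrite ler_pM2l.
rewrite le_eqVlt; apply/orP; left; apply/eqP.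
by rewrite /p; field; rewrite gt_eqF.
Qed.

Lemma quotient_le t s u : 0 <= t -> 0 < s -> s <= u ->
  quotient t s <= quotient t u.
Proof.
move=> t0 s0 su; have u0 := lt_le_trans s0 su.
rewrite /quotient ler_pdivrMr// mulrAC ler_pdivlMr//.
have := @convex_chord t (t + s) (t + u) t0.
by rewrite lerDl lerD2l (ltW s0) => /(_ isT su); lra.
Qed.

(** As [s] decreases to 0 the quotients decrease and stay nonnegative, so the [lim] in
    [right_derivative] is a genuine limit. *)
Lemma right_derivative_cvg t : 0 <= t ->
  quotient t s @[s --> 0^'+] --> right_derivative psi t.
Proof.
move=> t0; apply: (@nondecreasing_at_right_is_cvgr _ (quotient t) 0).
  near=> x => s1 s2; rewrite !in_itv/= => /andP[s10 _] _ s12.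
  exact: quotient_le.
near=> x; exists 0 => _ [s /= + <-]; rewrite in_itv/= => /andP[s0 _].
by rewrite divr_ge0 ?(ltW s0)// subr_ge0 admissible_le// lerDl ltW.
Unshelve. all: by end_near. Qed.

Lemma right_derivative_ge l t : 0 <= t ->
  (forall s, 0 < s -> l <= quotient t s) -> l <= right_derivative psi t.
Proof.
move=> t0 lq; have q_cvg := right_derivative_cvg t0.
apply: (cvgr_to_ge q_cvg).
near=> s; apply: lq; near: s; exact: nbhs_right_gt.
Unshelve. all: by end_near. Qed.

Lemma right_derivative_le t s : 0 <= t -> 0 < s ->
  right_derivative psi t <= quotient t s.
Proof.
move=> t0 s0; have q_cvg := right_derivative_cvg t0.
apply: (cvgr_to_le q_cvg).
near=> u.
have u0 : 0 < u by near: u; exact: nbhs_right_gt.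
have us : u < s by near: u; exact: nbhs_right_lt.
exact: quotient_le (ltW us).
Unshelve. all: by end_near. Qed.

(** The slope of the chord over [[s, t]] separates the two derivatives. *)
Lemma right_derivative_homo s t : 0 <= s -> s <= t ->
  right_derivative psi s <= right_derivative psi t.
Proof.
move=> s0; rewrite le_eqVlt => /predU1P[-> //|st].
have t0 : 0 <= t := le_trans s0 (ltW st).
apply: right_derivative_ge => // u u0.
apply: (le_trans (right_derivative_le s0 (_ : 0 < t - s))).
  by rewrite subr_gt0.
rewrite /quotient [s + _]addrC subrK ler_pdivrMr ?subr_gt0// mulrAC ler_pdivlMr//.
have := @convex_chord s t (t + u) s0 (ltW st).
by rewrite lerDl => /(_ (ltW u0)); lra.
Qed.

(** Since [psi 0 = 0], the ratio is the slope of the chord from 0 to [rho], which no later chord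
    undercuts. *)
Lemma ratio_le_right_derivative rho t : 0 < rho -> rho <= t ->
  psi rho / rho <= right_derivative psi t.
Proof.
move=> rho0 rho_t; apply: le_trans (right_derivative_homo (ltW rho0) rho_t).
apply: right_derivative_ge => [|s s0]; first exact: ltW.
rewrite /quotient ler_pdivrMr// mulrAC ler_pdivlMr//.
case: psi_admissible => _ _ psi0 _.
have := @convex_chord 0 rho (rho + s) (lexx 0) (ltW rho0).
by rewrite lerDl psi0 => /(_ (ltW s0)); lra.
Qed.

(** The case [d = +oo] is that of an empty inverse image; covering it lets solvability follow from
    the same estimate as regularity. *)
Lemma ratio_le_extend_right_derivative rho d : 0 < rho -> (rho%:E <= d)%E ->
  ((psi rho / rho)%:E <= extend (right_derivative psi) d)%E.
Proof.
move=> rho0; case: d => [t| |] //=.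
  by rewrite !lee_fin; exact: ratio_le_right_derivative.
(* below 0 the right derivative is a junk value, hence the truncation *)
move=> _; pose g s := (right_derivative psi (Num.max s 0))%:E.
have g_homo : nondecreasing_fun g.
  move=> s t st; rewrite lee_fin; apply: right_derivative_homo.
    by rewrite le_max lexx orbT.
  by rewrite ge_max !le_max st lexx orbT.
have psi'_cvg : ((right_derivative psi s)%:E @[s --> +oo] --> ereal_sup (range g)).
  apply: cvg_trans (nondecreasing_cvge g_homo); apply: near_eq_cvg.
  by near=> s; rewrite /g max_l.
apply: lime_ge; first by apply/cvg_ex; exists (ereal_sup (range g)).
by near=> s; rewrite lee_fin; exact: ratio_le_right_derivative.
Unshelve. all: by end_near. Qed.

End ConvexAdmissible.

(** * Euclidean inner product and norm *)

Section EuclideanTheory.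
Context {R : realType}.

Section OneSpace.
Context {n : nat}.
Implicit Types u v w : 'rV[R]_n.

Lemma dotpC u v : dotp u v = dotp v u.
Proof. by apply: eq_bigr => i _; rewrite mulrC. Qed.

Lemma dotpDl u v w : dotp (u + v) w = dotp u w + dotp v w.
Proof. by rewrite -big_split; apply: eq_bigr => i _; rewrite mxE mulrDl. Qed.

Lemma dotpZl k u v : dotp (k *: u) v = k * dotp u v.
Proof. by rewrite /dotp mulr_sumr; apply: eq_bigr => i _; rewrite mxE mulrA. Qed.

Lemma dotpNl u v : dotp (- u) v = - dotp u v.
Proof. by rewrite -scaleN1r dotpZl mulN1r. Qed.

Lemma dotpDr u v w : dotp w (u + v) = dotp w u + dotp w v.
Proof. by rewrite dotpC dotpDl !(dotpC w). Qed.

Lemma dotpZr k u v : dotp v (k *: u) = k * dotp v u.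
Proof. by rewrite dotpC dotpZl dotpC. Qed.

Lemma dotpNr u v : dotp v (- u) = - dotp v u.
Proof. by rewrite dotpC dotpNl dotpC. Qed.

Definition dotpE := (dotpDl, dotpDr, dotpNl, dotpNr, dotpZl, dotpZr).

Lemma enorm_sqr u : enorm u ^+ 2 = dotp u u.
Proof. by rewrite sqr_sqrtr// sumr_ge0// => i _; rewrite -expr2 sqr_ge0. Qed.

Lemma enorm_ge0 u : 0 <= enorm u.
Proof. exact: sqrtr_ge0. Qed.

Lemma enorm_sqrD u v :
  enorm (u + v) ^+ 2 = enorm u ^+ 2 + 2 * dotp u v + enorm v ^+ 2.
Proof. by rewrite !enorm_sqr !dotpE (dotpC v u); ring. Qed.

Lemma enormZ k u : 0 <= k -> enorm (k *: u) = k * enorm u.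
Proof.
move=> k0; rewrite /enorm !dotpE mulrA -expr2 sqrtrM ?sqr_ge0//.
by rewrite sqrtr_sqr ger0_norm.
Qed.

Lemma enormN u : enorm (- u) = enorm u.
Proof. by rewrite /enorm !dotpE opprK. Qed.

Lemma enormB u v : enorm (u - v) = enorm (v - u).
Proof. by rewrite -enormN opprB. Qed.

Lemma enorm_coord_le u i : `|u 0 i| <= enorm u.
Proof.
rewrite -sqrtr_sqr ler_wsqrtr// /dotp (bigD1 i)//= -expr2 lerDl.
by rewrite sumr_ge0// => j _; rewrite -expr2 sqr_ge0.
Qed.

Lemma enorm0 : enorm (0 : 'rV[R]_n) = 0.
Proof. by rewrite -(scale0r 0) enormZ// mul0r. Qed.

Lemma enorm_eq0 u : (enorm u == 0) = (u == 0).
Proof.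
apply/eqP/eqP => [u0|->]; last exact: enorm0.
apply/rowP => i; rewrite mxE; apply/eqP; rewrite -normr_le0 -u0.
exact: enorm_coord_le.
Qed.

(** Expand the square of the norm of [enorm v *: u - enorm u *: v] and divide by
    [enorm u * enorm v]. *)
Lemma dotp_le u v : dotp u v <= enorm u * enorm v.
Proof.
have [->|u0] := eqVneq u 0.
  by rewrite enorm0 mul0r -(scale0r 0) dotpZl mul0r.
have [->|v0] := eqVneq v 0.
  by rewrite enorm0 mulr0 -(scale0r 0) dotpZr mul0r.
have uv0 : 0 < enorm u * enorm v.
  by rewrite mulr_gt0// lt_neqAle enorm_ge0 eq_sym enorm_eq0 (u0, v0).
have := sqr_ge0 (enorm (enorm v *: u - enorm u *: v)).
rewrite enorm_sqr !dotpE (dotpC v u) -!enorm_sqr => le0.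
by rewrite -(ler_pM2l uv0); lra.
Qed.

Lemma enormD u v : enorm (u + v) <= enorm u + enorm v.
Proof.
rewrite -(@ler_pXn2r _ 2)// ?nnegrE ?addr_ge0 ?enorm_ge0//.
by rewrite enorm_sqrD; have := dotp_le u v; lra.
Qed.

Lemma enorm_triangle u v w : enorm (u - w) <= enorm (u - v) + enorm (v - w).
Proof. by rewrite (le_trans _ (enormD _ _))// addrA subrK. Qed.

(** Transfers Euclidean bounds to the sup norm, in which [bounded_set] is expressed. *)
Lemma mx_norm_le_enorm u : `|u| <= enorm u.
Proof.
rewrite [`|u|]mx_normrE; apply/bigmax_leP; split; first exact: enorm_ge0.
by move=> [i j] _ /=; rewrite (ord1 i); exact: enorm_coord_le.
Qed.

Lemma enorm_continuous (T : topologicalType) (g : T -> 'rV[R]_n) :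
  (forall i, continuous (fun t => g t 0 i)) -> continuous (enorm \o g).
Proof.
move=> g_cont t.
have dotp_cont : {for t, continuous (fun t => dotp (g t) (g t))}.
  apply: cvg_big => [|i _]; first exact: add_continuous.
  exact: cvgM (g_cont i t) (g_cont i t).
exact: (continuous_comp dotp_cont (@sqrt_continuous R _)).
Qed.

Lemma coordB_continuous (i : 'I_n) c :
  continuous (fun w : 'rV[R]_n => w 0 i - c : R).
Proof.
move=> w; have coord_cont : {for w, continuous (fun w : 'rV[R]_n => w 0 i : R)}.
  exact: coord_continuous.
have cst_cont : {for w, continuous (fun=> c : R)} by exact: cst_continuous.
exact: continuousB coord_cont cst_cont.
Qed.

Lemma near_eball u e : 0 < e -> \forall v \near u, eball u e v.
Proof.
move=> e0; have : continuous (enorm \o (fun v => v - u)).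
  apply: enorm_continuous => i.
  rewrite (_ : (fun _ => _) = fun w : 'rV[R]_n => w 0 i - u 0 i).
    exact: coordB_continuous.
  by apply/funext => w; rewrite !mxE.
move/(_ u) => cvgu.
have := cvgr_lt _ cvgu; apply.
by rewrite /= subrr enorm0.
Qed.

(** * Normal vectors and distance to a set *)

Lemma frechet_limiting_normal (A : set 'rV[R]_n) a s :
  A a -> frechet_normal A a s -> limiting_normal A a s.
Proof.
by move=> Aa As; exists (fun=> a), (fun=> s); split=> //; exact: cvg_cst.
Qed.

(** The quotient in the limsup is at most [K * enorm (y - a)], which tends to 0. *)
Lemma proximal_frechet_normal (A : set 'rV[R]_n) a s K :
  (forall y, A y -> dotp s (y - a) <= K * enorm (y - a) ^+ 2) ->
  frechet_normal A a s.
Proof.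
move=> sK; apply/lee_addgt0Pr => e e0; rewrite add0e.
pose d := e / (`|K| + 1).
have K1 : 0 < `|K| + 1 by rewrite ltr_wpDl.
have d0 : 0 < d by rewrite divr_gt0.
(* The limsup is an infimum of suprema over sets of the filter; the punctured ball of radius [d]
   within [A] already gives a supremum at most [e]. *)
apply: ereal_inf_le; exists (ereal_sup [set (dotp s (y - a) / enorm (y - a))%:E |
    y in [set y | [/\ A y, y != a & eball a d y]]]); last first.
  apply: ge_ereal_sup => _ [y [Ay ya yd] <-]; rewrite lee_fin.
  have ya0 : 0 < enorm (y - a).
    by rewrite lt_neqAle enorm_ge0 eq_sym enorm_eq0 subr_eq0 ya.
  rewrite ler_pdivrMr// (le_trans (sK _ Ay))// expr2 mulrA ler_pM2r//.
  apply: (@le_trans _ _ ((`|K| + 1) * enorm (y - a))).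
    by rewrite ler_pM2r// (le_trans (ler_norm K))// lerDl.
  by rewrite mulrC -ler_pdivlMr// ltW.
exists [set y | [/\ A y, y != a & eball a d y]] => //.
apply: filterS (near_eball a d0).
by move=> y yd ya Ay.
Qed.

Lemma edistance_le_enorm x a (A : set 'rV[R]_n) :
  A a -> (edistance x A <= (enorm (x - a))%:E)%E.
Proof. by move=> Aa; apply: ereal_inf_lbound; exists a. Qed.

Lemma edistance_leD x u (A : set 'rV[R]_n) :
  (edistance x A <= (enorm (x - u))%:E + edistance u A)%E.
Proof.
rewrite -leeBlDl//; apply: le_ereal_inf_tmp => _ [a Aa <-].
rewrite leeBlDl// (le_trans (edistance_le_enorm x Aa))// lee_fin.
exact: enorm_triangle.
Qed.

End OneSpace.

Lemma dotp_row_mx m n (u u' : 'rV[R]_m) (v v' : 'rV[R]_n) :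
  dotp (row_mx u v) (row_mx u' v') = dotp u u' + dotp v v'.
Proof.
rewrite /dotp big_split_ord/=; congr (_ + _); apply: eq_bigr => i _.
  by rewrite !row_mxEl.
by rewrite !row_mxEr.
Qed.

Lemma enorm_sqr_row_mx m n (u : 'rV[R]_m) (v : 'rV[R]_n) :
  enorm (row_mx u v) ^+ 2 = enorm u ^+ 2 + enorm v ^+ 2.
Proof. by rewrite !enorm_sqr dotp_row_mx. Qed.

End EuclideanTheory.

(** * Minimisation of a penalised residual over a closed graph *)

Section PenalizedDistance.
Context {R : realType} {n m : nat} (F : 'rV[R]_n -> set 'rV[R]_m).
Variables (x : 'rV[R]_n) (y : 'rV[R]_m) (C : R).
Hypothesis C0 : 0 < C.

(** The residual is left unsquared so that the normal at a minimiser has a factor [enorm (w - y)] in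
    its first component, matching the [enorm h ^+ 2] of the second-order hypothesis. *)
Definition penalized_dist u w : R := enorm (w - y) + C * enorm (u - x) ^+ 2.

Lemma penalized_dist_continuous :
  continuous (fun p => penalized_dist (lsubmx p) (rsubmx p)).
Proof.
have lsub : continuous (enorm \o (fun p : 'rV[R]_(n + m) => lsubmx p - x)).
  apply: enorm_continuous => i.
  rewrite (_ : (fun _ => _) = fun q : 'rV[R]_(n + m) => q 0 (lshift m i) - x 0 i).
    exact: coordB_continuous.
  by apply/funext => q; rewrite !mxE.
have rsub : continuous (enorm \o (fun p : 'rV[R]_(n + m) => rsubmx p - y)).
  apply: enorm_continuous => i.
  rewrite (_ : (fun _ => _) = fun q : 'rV[R]_(n + m) => q 0 (rshift n i) - y 0 i).
    exact: coordB_continuous.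
  by apply/funext => q; rewrite !mxE.
move=> p.
have lsub2 : {for p, continuous (fun q => enorm (lsubmx q - x) ^+ 2 : R)}.
  exact: continuousM (lsub p) (lsub p).
have cst_cont : {for p, continuous (fun=> C : R)} by exact: cst_continuous.
exact: continuousD (rsub p) (continuousM cst_cont lsub2).
Qed.

Lemma penalized_dist_bounded a :
  bounded_set [set p | penalized_dist (lsubmx p) (rsubmx p) <= a].
Proof.
pose c : 'rV[R]_(n + m) := row_mx x y.
(* Recentring at [c] costs its norm; then the squared norm of [p - c] is at most [a / C + a ^+ 2],
   hence at most [(a / C + 1 + a) ^+ 2]. *)
exists (`|c| + a / C + 1 + a); split; first exact: num_real.
move=> M aM p /= pa; apply: le_trans (ltW aM).
rewrite -[p](subrK c) (le_trans (ler_normD _ _))// addrC -!addrA lerD2l.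
rewrite (le_trans (mx_norm_le_enorm _))//.
have dl := enorm_ge0 (lsubmx p - x); have dr := enorm_ge0 (rsubmx p - y).
have dl2 : enorm (lsubmx p - x) ^+ 2 <= a / C.
  by rewrite ler_pdivlMr// mulrC (le_trans _ pa)// lerDr.
have dra : enorm (rsubmx p - y) <= a.
  by rewrite (le_trans _ pa)// lerDl mulr_ge0 ?sqr_ge0 ?ltW.
have aC : 0 <= a / C by rewrite (le_trans _ dl2) ?sqr_ge0.
have pcE : p - c = row_mx (lsubmx p - x) (rsubmx p - y).
  by rewrite -{1}[p]hsubmxK opp_row_mx add_row_mx.
rewrite -(@ler_pXn2r _ 2)// ?nnegrE ?enorm_ge0//; last by lra.
by rewrite pcE enorm_sqr_row_mx; nra.
Qed.

(** The sublevel set at the value taken at [(x, v)] is compact in the graph, and points outside it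
    have larger values. *)
Lemma penalized_dist_min v : closed (gph F) -> F x v ->
  exists u w, F u w /\
    forall u' w', F u' w' -> penalized_dist u w <= penalized_dist u' w'.
Proof.
move=> gphF Fxv; pose J p := penalized_dist (lsubmx p) (rsubmx p).
pose A := gph F `&` [set p | J p <= enorm (v - y)].
have Axv : A (row_mx x v).
  split; first by rewrite /gph/= row_mxKl row_mxKr.
  by rewrite /J/= row_mxKl row_mxKr /penalized_dist subrr enorm0 expr0n mulr0 addr0.
have A_compact : compact A.
  apply: bounded_closed_compact.
    have [M [Mr MA]] := penalized_dist_bounded (enorm (v - y)).
    by exists M; split=> // N MN p [_ /(MA N MN)].
  apply: closedI => //.
  by apply: (closed_comp (f := J)) (@closed_le _ _) => p _; exact: penalized_dist_continuous.
have [p] := compact_EVT_min (ex_intro _ _ Axv) A_compact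
  (continuous_subspaceT penalized_dist_continuous).
rewrite inE => -[Fp Jp] pmin.
exists (lsubmx p), (rsubmx p); split=> // u w Fuw.
have [Juw|Juw] := leP (penalized_dist u w) (enorm (v - y)).
  have := pmin (row_mx u w); rewrite inE row_mxKl row_mxKr; apply.
  by split; rewrite /J /gph/= row_mxKl row_mxKr.
exact: le_trans Jp (ltW Juw).
Qed.

(** Fermat's rule: the vector is minus the gradient of the objective, which exists as [w != y],
    scaled by [enorm (w - y)] to give the second component the form required by [second_subdiff]. *)
Lemma penalized_dist_normal u w : w != y ->
  (forall u' w', F u' w' -> penalized_dist u w <= penalized_dist u' w') ->
  frechet_normal (gph F) (row_mx u w)
    (row_mx (- (2 * C * enorm (w - y)) *: (u - x)) (- (w - y))).
Proof.
move=> wy uw_min; set e := u - x; set h := w - y.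
have h0 : 0 < enorm h by rewrite lt_neqAle enorm_ge0 eq_sym enorm_eq0 subr_eq0 wy.
(* [C * enorm h] pays for the quadratic penalty, [2^-1] for the second-order error of the norm. *)
apply: (@proximal_frechet_normal _ _ _ _ _ (C * enorm h + 2^-1)) => p Fp.
set du := lsubmx p - u; set dw := rsubmx p - w.
have -> : p - row_mx u w = row_mx du dw.
  by rewrite -{1}[p]hsubmxK opp_row_mx add_row_mx.
rewrite enorm_sqr_row_mx dotp_row_mx dotpZl dotpNl.
have := uw_min _ _ Fp; rewrite /penalized_dist -/e -/h.
have -> : rsubmx p - y = h + dw by rewrite [RHS]addrC addrA subrK.
have -> : lsubmx p - x = e + du by rewrite [RHS]addrC addrA subrK.
rewrite (enorm_sqrD e du) => le_J.
have hdw := enorm_sqrD h dw; have hdw0 := enorm_ge0 (h + dw).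
(* AM-GM: [2 |h| |h + dw| <= |h|^2 + |h + dw|^2] makes the norm smooth *)
have amgm := sqr_ge0 (enorm (h + dw) - enorm h).
have le_hJ : enorm h * (enorm h + C * enorm e ^+ 2) <= enorm h *
    (enorm (h + dw) + C * (enorm e ^+ 2 + 2 * dotp e du + enorm du ^+ 2)).
  by rewrite ler_pM2l.
have du2 := sqr_ge0 (enorm du); have dw2 := sqr_ge0 (enorm dw).
have : 0 <= C * enorm h * enorm dw ^+ 2 by rewrite mulr_ge0 ?sqr_ge0// mulr_ge0 ?ltW.
move=> Chdw; rewrite !expr2 in amgm le_hJ hdw du2 dw2 Chdw *.
lra.
Qed.

End PenalizedDistance.

(** * From the second-order condition to a residual bound *)

Section SecondOrder.
Context {R : realType} {n : nat} (f : 'rV[R]_n -> \bar R) (psi : R -> R).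
Variables (xbar : 'rV[R]_n) (kappa r : R).
Hypothesis psi_admissible : admissible psi.
Hypothesis psi_convex : convex_function (E := R^o) `[0, +oo[%classic psi.
Hypothesis gph_closed : closed (gph (subdiff f)).
Hypothesis kappa0 : 0 < kappa.
Hypothesis second_order : forall x v h : 'rV[R]_n, subdiff f x v ->
  eball xbar r x -> eball 0 r v -> eball 0 r h ->
  forall z, second_subdiff f x v h z ->
    ((kappa * enorm h ^+ 2)%:E * eta_psi psi f x v h <= (dotp z h)%:E)%E.

(** The two bounds by [r] keep the minimiser [(u, w)] and [h = w - y] in the balls where the
    second-order hypothesis applies. *)
Lemma psi_le_residual x v y rho : subdiff f x v -> 0 < rho ->
  enorm (x - xbar) + rho < r -> enorm (v - y) + enorm y < r ->
  ((2 * rho)%:E <= edistance x (inv_map (subdiff f) y))%E ->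
  kappa * psi rho <= 2 * enorm (v - y).
Proof.
move=> fxv rho0 x_r v_r far.
set S := inv_map (subdiff f) y in far.
have not_near u : S u -> enorm (x - u) <= rho -> False.
  move=> Su xu; have := le_trans far (edistance_le_enorm x Su).
  by rewrite lee_fin => /le_trans/(_ xu); lra.
set a := enorm (v - y).
have a0 : 0 < a.
  rewrite lt_neqAle enorm_ge0 eq_sym enorm_eq0 subr_eq0 andbT.
  apply/eqP => vy; apply: (not_near x); first by rewrite /S /inv_map/= -vy.
  by rewrite subrr enorm0 ltW.
pose C := a / rho ^+ 2.
have C0 : 0 < C by rewrite divr_gt0 ?exprn_gt0.
have CE : C * rho ^+ 2 = a by rewrite /C divfK// gt_eqF ?exprn_gt0.
have [u [w [fuw uw_min]]] := penalized_dist_min y C0 gph_closed fxv.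
have := uw_min _ _ fxv.
rewrite /penalized_dist subrr enorm0 expr0n mulr0 addr0 -/a.
set e := u - x; set h := w - y => uw_le.
have h_ge0 := enorm_ge0 h; have e_ge0 := enorm_ge0 e.
have Ce_ge0 : 0 <= C * enorm e ^+ 2 by rewrite mulr_ge0 ?sqr_ge0 ?ltW.
have h_le : enorm h <= a by lra.
have e_le : enorm e <= rho.
  rewrite -(@ler_pXn2r _ 2)// ?nnegrE ?(ltW rho0)// -(ler_pM2l C0) CE; lra.
(* If [w = y], then [u] is a point of [S] within [rho] of [x], against [far]. *)
have [wy|wy] := eqVneq w y.
  by exfalso; apply: (not_near u); [rewrite /S /inv_map/= -wy|rewrite enormB].
have h0 : 0 < enorm h by rewrite lt_neqAle h_ge0 eq_sym enorm_eq0 subr_eq0 wy.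
have normal := penalized_dist_normal C0 wy uw_min.
have u_r : eball xbar r u.
  rewrite /eball/= (le_lt_trans (enorm_triangle _ x _))//.
  by rewrite (le_lt_trans _ x_r)// addrC lerD2l.
have w_r : eball 0 r w.
  rewrite /eball/= subr0 -[w](subrK y) (le_lt_trans (enormD _ _))//.
  by rewrite (le_lt_trans _ v_r)// lerD2r.
have h_r : eball 0 r h.
  by rewrite /eball/= subr0 (le_lt_trans _ v_r)// (le_trans h_le)// lerDl enorm_ge0.
have guw : gph (subdiff f) (row_mx u w) by rewrite /gph/= row_mxKl row_mxKr.
have := second_order fuw u_r w_r h_r (frechet_limiting_normal guw normal).
(* As [w - (w - y) = y], the distance in [eta_psi] is that from [u] to [S]. *)
rewrite /eta_psi /h subKr -/S -/h => so.
have dist_u : (rho%:E <= edistance u S)%E.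
  have := le_trans far (edistance_leD x u S).
  rewrite -leeBlDl// => /(le_trans _); apply.
  by rewrite -EFinB lee_fin enormB -/e; lra.
have := ratio_le_extend_right_derivative psi_admissible psi_convex rho0 dist_u.
have kh0 : 0 < kappa * enorm h ^+ 2 by rewrite mulr_gt0 ?exprn_gt0.
rewrite -(@lee_pmul2l _ (kappa * enorm h ^+ 2)%:E)// => /le_trans/(_ so).
rewrite -EFinM lee_fin -/e dotpZl.
have := dotp_le (- e) h; rewrite dotpNl enormN => eh.
have Ch_ge0 : 0 <= 2 * C * enorm h by rewrite mulr_ge0// mulr_ge0// ltW.
have : 0 <= 2 * C * enorm h * (rho * enorm h - enorm e * enorm h).
  by rewrite mulr_ge0// -mulrBl mulr_ge0// subr_ge0.
have : 0 <= 2 * C * enorm h * (enorm e * enorm h + dotp e h).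
  by rewrite mulr_ge0//; lra.
move=> eh0 rho_e normal_le.
have H0 : 0 < enorm h ^+ 2 by rewrite exprn_gt0.
(* Cauchy-Schwarz and [enorm e <= rho] leave the common factor [enorm h ^+ 2]; after cancelling it,
   [CE] turns [2 * C * rho * rho] into [2 * a]. *)
have : enorm h ^+ 2 * (kappa * (psi rho / rho)) <= enorm h ^+ 2 * (2 * C * rho).
  by rewrite !expr2 in normal_le *; lra.
rewrite ler_pM2l// mulrA ler_pdivrMr//; move: CE; rewrite expr2; lra.
Qed.

End SecondOrder.

(** * Metric regularity from the residual bound *)

Theorem proposition6p1 (R : realType) (n : nat) (f : 'rV[R]_n -> \bar R)
    (psi : R -> R) (xbar : 'rV[R]_n)
    (f_proper : proper_function f) (f_lsc : lower_semicontinuous f)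
    (psi_admissible : admissible psi)
    (psi_convex : convex_function (E := R^o) `[0, +oo[%classic psi)
    (xbar0 : subdiff f xbar 0)
    (gph_closed : closed (gph (subdiff f)))
    (second_order : exists kappa r : R, [/\ 0 < kappa, 0 < r &
       forall x v h : 'rV[R]_n, subdiff f x v ->
         eball xbar r x -> eball 0 r v -> eball 0 r h ->
         forall z, second_subdiff f x v h z ->
           ((kappa * enorm h ^+ 2)%:E * eta_psi psi f x v h <= (dotp z h)%:E)%E]) :
  metrically_regular psi (subdiff f) xbar 0.
Proof.
have [kappa [r [kappa0 r0 so]]] := second_order.
have residual := psi_le_residual psi_admissible psi_convex gph_closed kappa0 so.
have r4 : 0 < r / 4 by lra.
have psi_r4 := admissible_gt0 psi_admissible r4.
(* The first entry localises [x] and [y]; the second contradicts the residual bound at [(xbar, 0)]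
   with [rho = r / 4]. *)
pose r' := Num.min (r / 4) (kappa * psi (r / 4) / 2).
have r'_le : r' <= r / 4 by rewrite ge_min lexx.
have r'_le_psi : r' <= kappa * psi (r / 4) / 2 by rewrite ge_min lexx orbT.
have r'0 : 0 < r' by rewrite lt_min r4 divr_gt0// mulr_gt0.
(* The first summand serves residuals below [r / 2], the second the others. *)
pose kappa' := 2 / kappa + 2 * psi (r / 4) / r.
have kr0 : 0 < 2 / kappa by rewrite divr_gt0.
have pr0 : 0 < 2 * psi (r / 4) / r by rewrite divr_gt0// mulr_gt0.
have kappa'0 : 0 < kappa' by rewrite addr_gt0.
exists r', (4^-1), kappa'; split=> // x y; rewrite /eball/= subr0 => x_r' y_r'.
set S := inv_map (subdiff f) y.
have S_near : (edistance xbar S < (r / 2)%:E)%E.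
  rewrite ltNge; apply/negP => far.
  have := residual xbar 0 y (r / 4) xbar0 r4.
  rewrite subrr enorm0 add0r sub0r enormN.
  have -> : 2 * (r / 4) = r / 2 by lra.
  move=> /(_ _ _ far); lra.
have x_lt : (edistance x S < r%:E)%E.
  apply: le_lt_trans (edistance_leD x xbar S) _.
  have -> : r = r / 2 + r / 2 by lra.
  by rewrite EFinD lteD// lte_fin; lra.
have x_ge0 : (0 <= edistance x S)%E.
  by apply: le_ereal_inf_tmp => _ [a _ <-]; rewrite lee_fin enorm_ge0.
case DE : (edistance x S) x_lt x_ge0 => [D| |]//.
rewrite lte_fin lee_fin => D_lt D_ge0 /=.
(* It suffices to treat each [v] in [subdiff f x]; if there is none, the right-hand side is
   infinite. *)
rewrite -lee_pdivrMl// -EFinM; apply: le_ereal_inf_tmp => _ [v fxv <-].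
rewrite lee_fin mulrC ler_pdivrMr// [4^-1 * D]mulrC enormB.
have vy0 := enorm_ge0 (v - y).
have [->|D0] := eqVneq D 0.
  case: psi_admissible => _ _ psi0 _.
  by rewrite mul0r psi0 mulr_ge0// ?ltW.
have {}D0 : 0 < D by rewrite lt_neqAle eq_sym D0.
have [vy_lt|vy_ge] := ltP (enorm (v - y)) (r / 2).
  (* Here [D < r] and [enorm (v - y) < r / 2] provide the localisation for [rho = D / 4]. *)
  have := residual x v y (D / 4) fxv.
  rewrite -/S DE lee_fin => res.
  have {res} : kappa * psi (D / 4) <= 2 * enorm (v - y) by apply: res; lra.
  rewrite -ler_pdivlMl// => /le_trans; apply.
  have : 0 <= enorm (v - y) * (2 * psi (r / 4) / r) by rewrite mulr_ge0// ltW.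
  rewrite /kappa'; lra.
(* For a large residual no second-order information is used: [D < r] bounds the left side by
   [psi (r / 4)], which is [r / 2] times the second summand of [kappa']. *)
apply: (@le_trans _ _ (psi (r / 4))).
  by apply: admissible_le => //; lra.
rewrite /kappa' mulrDr; apply: (@le_trans _ _ (enorm (v - y) * (2 * psi (r / 4) / r))).
  apply: le_trans (ler_wpM2r (ltW pr0) vy_ge).
  by rewrite le_eqVlt; apply/orP; left; apply/eqP; field; rewrite gt_eqF.
by rewrite lerDr mulr_ge0// ?ltW.
Qed.
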